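(* Consider the linear damage benchmark described in the context, with $\rho>0$, $\alpha>0$, $q_S>0$. Fix all parameters except $\lambda_S\in[0,\infty)$, let $B$ be a broad-release policy, let $\mathsf{C}$ denote controlled access, and define $\Psi(\lambda_S)=W(B)-W(\mathsf{C})$. Then $\Psi$ is strictly increasing, with $$\frac{\partial\Psi}{\partial\lambda_S}=\frac{\alpha q_S}{(\lambda_S+\rho)^2}>0.$$ If $\Psi(0)<0<\lim_{\lambda_S\to\infty}\Psi(\lambda_S)$, then there exists a unique $\lambda_S^*$ such that controlled access is preferred ($\Psi(\lambda_S)<0$) for $\lambda_S<\lambda_S^*$ and broad release is preferred ($\Psi(\lambda_S)>0$) for $\lambda_S>\lambda_S^*$. In particular, defining $$\theta=-\frac{\rho\,\Psi(0)}{\alpha q_S},$$ one has $\theta\in(0,1)$ and $$\lambda_S^*=\rho\,\frac{\theta}{1-\theta}.$$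
   Context: Linear benchmark. Let $F(\lambda)=\lambda/(\lambda+\rho)$, where $\rho>0$ is the discount rate. The real parameters are: adversary and defender substitute-acquisition rates $\lambda_S,\lambda_D$; direct capability uplifts $q_S,q_D$; harm coefficients $\alpha,\beta$; baseline harm $\bar h$; defensive network productivity $\eta$; defensive reaches $n_{\mathsf C},n_B$; effective defensive capabilities $d_{\mathsf C}=q_D+\eta n_{\mathsf C}$ and $d_B=q_D+\eta n_B$; opportunistic-misuse flows $m_{\mathsf C}$ (under control) and $m_O$ (under open release); defensive friction $f_B$ and misuse deterrence $\delta_B$ of the broad policy; benefit flows $b_{\mathsf C},b_B$; one-time costs $I_{\mathsf C},I_B$. (Parameters are taken in a region where instantaneous harm is nonnegative.) The discounted losses are $$J_{\mathsf C}=\frac1\rho\left[\bar h+\alpha q_SF(\lambda_S)-\beta d_{\mathsf C}F(\lambda_D)+m_{\mathsf C}\right],$$ $$J_B=\frac1\rho\left[\bar h+\alpha q_S-\beta(1-f_B)d_B+(1-\delta_B)m_O\right],$$ and social welfare of policy $r\in\{\mathsf C,B\}$ is $$W(r)=\frac{b_r}{\rho}-J_r-I_r.$$ Here $B$ is either of two open-weight policies (safeguarded or minimally restricted); a policy is preferred over another if its welfare is larger. *)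

(* Defs.v *)
From Stdlib Require Export Reals.
From Coquelicot Require Export Coquelicot.
Local Open Scope R_scope.

Inductive open_policy : Set := Safeguarded | MinimallyRestricted.

Inductive policy : Set := Controlled | Broad (B : open_policy).

(* All parameters except the adversary's substitute-acquisition rate lambda_S.
   Only what bears on a single open-weight policy is indexed by [open_policy];
   the raw open-release misuse flow [m_open] is common to both of them. *)
Record benchmark : Set := Benchmark {
  rho : R;                      (* discount rate *)
  lambda_D : R;                 (* defender substitute-acquisition rate *)
  q_S : R;                      (* adversary's direct capability uplift *)
  q_D : R;                      (* defender's direct capability uplift *)
  alpha : R;                    (* harm coefficient of offensive capability *)
  beta : R;                     (* harm coefficient of defensive capability *)
  hbar : R;                     (* baseline harm *)
  eta : R;                      (* defensive network productivity *)
  m_control : R;                (* misuse flow under controlled access *)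
  m_open : R;                   (* misuse flow under open release *)
  reach : policy -> R;          (* defensive reach n_r *)
  friction : open_policy -> R;  (* defensive friction f_B *)
  deterrence : open_policy -> R; (* misuse deterrence delta_B *)
  benefit : policy -> R;        (* benefit flow b_r *)
  cost : policy -> R            (* one-time cost I_r *)
}.

Definition discount_weight (P : benchmark) (lambda : R) : R :=
  lambda / (lambda + rho P).

Definition effective_defense (P : benchmark) (r : policy) : R :=
  q_D P + eta P * reach P r.

(* The loss under a broad policy does not depend on lambda_S. *)
Definition loss (P : benchmark) (lambda_S : R) (r : policy) : R :=
  match r with
  | Controlled =>
      1 / rho P *
      (hbar P + alpha P * q_S P * discount_weight P lambda_S
       - beta P * effective_defense P Controlled
           * discount_weight P (lambda_D P)
       + m_control P)
  | Broad B =>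
      1 / rho P *
      (hbar P + alpha P * q_S P
       - beta P * (1 - friction P B) * effective_defense P (Broad B)
       + (1 - deterrence P B) * m_open P)
  end.

Definition welfare (P : benchmark) (lambda_S : R) (r : policy) : R :=
  benefit P r / rho P - loss P lambda_S r - cost P r.

Definition preferred (P : benchmark) (lambda_S : R) (r r' : policy) : Prop :=
  welfare P lambda_S r' < welfare P lambda_S r.

Definition Psi (P : benchmark) (B : open_policy) (lambda_S : R) : R :=
  welfare P lambda_S (Broad B) - welfare P lambda_S Controlled.

Definition is_switching_rate (P : benchmark) (B : open_policy) (l : R) : Prop :=
  0 <= l /\
  (forall lambda_S : R, 0 <= lambda_S -> lambda_S < l ->
     Psi P B lambda_S < 0 /\ preferred P lambda_S Controlled (Broad B)) /\
  (forall lambda_S : R, l < lambda_S ->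
     0 < Psi P B lambda_S /\ preferred P lambda_S (Broad B) Controlled).

Definition theta (P : benchmark) (B : open_policy) : R :=
  - (rho P * Psi P B 0 / (alpha P * q_S P)).

(* Main.v *)
Require Import Defs.
From Stdlib Require Import Reals Lra.
From Coquelicot Require Import Coquelicot.
Local Open Scope R_scope.

(** The adversary's rate enters welfare only through the loss under controlled
    access, so [Psi l = K * (F l - theta)] with [K = alpha * q_S / rho] and
    [F l = l / (l + rho)].  As [F] increases from 0 to 1, the limit of [Psi] is
    [K * (1 - theta)], and [Psi] changes sign where [F l = theta], that is, at
    [l = rho * theta / (1 - theta)]. *)

Lemma Psi_affine (P : benchmark) (B : open_policy) (l : R) :
  0 < rho P ->
  Psi P B l = Psi P B 0 + alpha P * q_S P / rho P * discount_weight P l.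
Proof.
intros Hrho; unfold Psi, welfare, loss.
(* The weight vanishes at 0, so [Psi P B 0] collects every term free of [l]. *)
replace (discount_weight P 0) with 0; [unfold Rdiv; ring|].
unfold discount_weight; field; lra.
Qed.

Lemma Psi_theta (P : benchmark) (B : open_policy) (l : R) :
  0 < rho P -> 0 < alpha P -> 0 < q_S P ->
  Psi P B l = alpha P * q_S P / rho P * (discount_weight P l - theta P B).
Proof.
intros Hrho Ha Hq; rewrite (Psi_affine P B l Hrho); unfold theta.
field; lra.
Qed.

Lemma is_derive_discount_weight (P : benchmark) (l : R) :
  l + rho P <> 0 ->
  is_derive (discount_weight P) l (rho P / (l + rho P) ^ 2).
Proof.
intros Hl; unfold discount_weight; auto_derive; [exact Hl|].
field; exact Hl.
Qed.

Lemma discount_weight_lt (P : benchmark) (x y : R) :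
  0 < rho P -> 0 <= x -> x < y -> discount_weight P x < discount_weight P y.
Proof.
intros Hrho Hx Hxy; apply Rlt_0_minus; unfold discount_weight.
(* Over a common denominator the terms in [x * y] cancel, leaving a quotient of positive factors. *)
replace (y / (y + rho P) - x / (x + rho P))
  with (rho P * (y - x) / ((x + rho P) * (y + rho P))) by (field; lra).
apply Rdiv_lt_0_compat; apply Rmult_lt_0_compat; lra.
Qed.

Lemma is_lim_discount_weight (P : benchmark) :
  0 < rho P -> is_lim (discount_weight P) p_infty 1.
Proof.
intros Hrho.
(* This form avoids a quotient of two infinities; it agrees with the weight for [l > 0], where the
   denominator is nonzero. *)
apply is_lim_ext_loc with (fun l => 1 - rho P * / (l + rho P)).
  exists 0; intros l Hl; unfold discount_weight; field; lra.
replace (Finite 1) with (Finite (1 - rho P * 0)) by (f_equal; ring).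
apply is_lim_minus'; [apply is_lim_const|].
apply (is_lim_scal_l (fun l => / (l + rho P)) (rho P) p_infty 0).
apply (is_lim_inv (fun l => l + rho P) p_infty p_infty); [|discriminate].
eapply is_lim_plus; [apply is_lim_id|apply is_lim_const|reflexivity].
Qed.

Lemma is_lim_Psi (P : benchmark) (B : open_policy) :
  0 < rho P ->
  is_lim (Psi P B) p_infty (Psi P B 0 + alpha P * q_S P / rho P).
Proof.
intros Hrho.
apply is_lim_ext with
  (fun l => Psi P B 0 + alpha P * q_S P / rho P * discount_weight P l).
  intros l; symmetry; apply Psi_affine, Hrho.
apply is_lim_plus'; [apply is_lim_const|].
replace (Finite (alpha P * q_S P / rho P))
  with (Rbar_mult (alpha P * q_S P / rho P) 1) by (simpl; f_equal; ring).
apply (is_lim_scal_l (discount_weight P) _ p_infty 1).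
exact (is_lim_discount_weight P Hrho).
Qed.

(** The argument is the solution [l] of [l / (l + rho P) = t]. *)
Lemma discount_weight_threshold (P : benchmark) (t : R) :
  0 < rho P -> t < 1 ->
  discount_weight P (rho P * (t / (1 - t))) = t.
Proof.
intros Hrho Ht; unfold discount_weight; field; split; [lra|].
(* The denominator [l + rho P], multiplied by [1 - t], is just [rho P]. *)
replace (rho P * t + rho P * (1 - t)) with (rho P) by ring; lra.
Qed.

(** A zero of a strictly increasing function separates its negative values from its positive ones,
    and each preference is a sign of [Psi] rearranged. *)
Lemma is_switching_rateI (P : benchmark) (B : open_policy) (l : R) :
  0 <= l ->
  (forall x y : R, 0 <= x -> x < y -> Psi P B x < Psi P B y) ->
  Psi P B l = 0 ->
  is_switching_rate P B l.
Proof.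
intros Hl Hincr H0; split; [exact Hl|]; unfold preferred.
split; intros x Hx; [intros Hxl|].
- assert (H := Hincr x l Hx Hxl); rewrite H0 in H.
  split; [exact H|]; unfold Psi in H; lra.
- assert (H := Hincr l x Hl Hx); rewrite H0 in H.
  split; [exact H|]; unfold Psi in H; lra.
Qed.

(** If [l < l'], then [Psi] would be both positive and negative at their midpoint. Used in both
    orders, this gives uniqueness. *)
Lemma is_switching_rate_le (P : benchmark) (B : open_policy) (l l' : R) :
  is_switching_rate P B l -> is_switching_rate P B l' -> l' <= l.
Proof.
intros (Hl & _ & Hgt) (_ & Hlt & _); apply Rnot_lt_le; intros Hll.
destruct (Hgt ((l + l') / 2)) as [Hpos _]; [lra|].
destruct (Hlt ((l + l') / 2)) as [Hneg _]; lra.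
Qed.

Theorem proposition3 (P : benchmark) (B : open_policy)
    (Hrho : 0 < rho P) (Halpha : 0 < alpha P) (HqS : 0 < q_S P) :
  (forall x y : R, 0 <= x -> x < y -> Psi P B x < Psi P B y) /\
  (forall l : R, 0 <= l ->
     is_derive (Psi P B) l (alpha P * q_S P / (l + rho P) ^ 2) /\
     0 < alpha P * q_S P / (l + rho P) ^ 2) /\
  (forall L : Rbar, is_lim (Psi P B) p_infty L ->
     Psi P B 0 < 0 -> Rbar_lt (Finite 0) L ->
     0 < theta P B < 1 /\
     exists lstar : R,
       unique (is_switching_rate P B) lstar /\
       lstar = rho P * (theta P B / (1 - theta P B))).
Proof.
assert (Haq : 0 < alpha P * q_S P) by (apply Rmult_lt_0_compat; assumption).
assert (HK : 0 < alpha P * q_S P / rho P)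
  by (apply Rdiv_lt_0_compat; assumption).
assert (Hincr : forall x y : R, 0 <= x -> x < y -> Psi P B x < Psi P B y).
{ intros x y Hx Hxy.
  rewrite (Psi_affine P B x Hrho), (Psi_affine P B y Hrho).
  apply Rplus_lt_compat_l, Rmult_lt_compat_l; [exact HK|].
  now apply discount_weight_lt. }
split; [exact Hincr|split].
- intros l Hl; split.
  + apply is_derive_ext with
      (fun t => Psi P B 0 + alpha P * q_S P / rho P * discount_weight P t).
      intros t; symmetry; apply Psi_affine, Hrho.
    replace (alpha P * q_S P / (l + rho P) ^ 2)
      with (0 + alpha P * q_S P / rho P * (rho P / (l + rho P) ^ 2))
      by (field; lra).
    apply @is_derive_plus; [apply @is_derive_const|].
    apply @is_derive_scal; apply is_derive_discount_weight; lra.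
  + apply Rdiv_lt_0_compat; [exact Haq|apply pow_lt; lra].
- intros L HL Hneg Hpos.
  (* Uniqueness of limits turns the hypothesis on an arbitrary [L] into one on an explicit real. *)
  assert (HLval : L = Psi P B 0 + alpha P * q_S P / rho P).
  { rewrite <- (is_lim_unique _ _ _ HL).
    exact (is_lim_unique _ _ _ (is_lim_Psi P B Hrho)). }
  rewrite HLval in Hpos; simpl in Hpos.
  (* With [K = alpha P * q_S P / rho P], the two sign hypotheses become [- (K * theta) < 0] and
     [0 < - (K * theta) + K]; cancelling [K] bounds [theta]. *)
  assert (HPsi0 : Psi P B 0 = - (alpha P * q_S P / rho P * theta P B))
    by (unfold theta; field; lra).
  rewrite HPsi0 in Hneg, Hpos.
  assert (Ht : 0 < theta P B < 1).
  { split; apply Rmult_lt_reg_l with (1 := HK); lra. }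
  split; [exact Ht|].
  exists (rho P * (theta P B / (1 - theta P B))); split; [|reflexivity].
  assert (Hsw : is_switching_rate P B (rho P * (theta P B / (1 - theta P B)))).
  { apply is_switching_rateI; [|exact Hincr|].
    - apply Rmult_le_pos; [lra|].
      apply Rlt_le, Rdiv_lt_0_compat; lra.
    - rewrite Psi_theta, discount_weight_threshold by lra; ring. }
  split; [exact Hsw|].
  intros l Hl; apply Rle_antisym; now apply is_switching_rate_le with P B.
Qed.
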